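(* If $\mathfrak{t}=\omega_1$, then $\overline{\mathfrak{a}}(\mathcal{NC})=\omega_1$.
   Context: $\mathfrak{t}$ is the tower number. For $A\subseteq\omega\times\omega$ and $n<\omega$ let $A(n)=\{m<\omega:(n,m)\in A\}$. A family $\mathcal{X}\subseteq[\omega]^\omega$ is centered if $\bigcap F$ is infinite for every finite nonempty $F\subseteq\mathcal{X}$. $\mathcal{NC}=\{A\subseteq\omega\times\omega:\ \text{for every } X\in[\omega]^\omega \text{ the family } \{A(n):n\in X\}\text{ is not centered}\}$ is an ideal on $\omega\times\omega$, $\mathcal{NC}^+=\mathcal{P}(\omega\times\omega)\setminus\mathcal{NC}$. An $\mathcal{NC}$-mad family is a subfamily of $\mathcal{NC}^+$ whose members pairwise have intersection in $\mathcal{NC}$, maximal with this property. $\overline{\mathfrak{a}}(\mathcal{NC})$ is the least size of an uncountable $\mathcal{NC}$-mad family. *)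

(* Defs.v *)
From mathcomp Require Import all_boot.
From mathcomp Require Import boolp classical_sets functions cardinality wochoice.

Set Implicit Arguments.
Unset Strict Implicit.
Unset Printing Implicit Defensive.

Local Open Scope classical_set_scope.
Local Open Scope card_scope.

(* The ordinal omega_1 is represented, up to isomorphism, by any uncountable
   well-order (R is the reflexive relation) all of whose proper initial
   segments are countable. *)
Definition is_omega1 (W : Type) (R : rel W) : Prop :=
  [/\ well_order R,
      ~ countable [set: W]
    & forall a : W, countable [set b | R b a /\ b <> a]].

Lemma omega1_exists : exists (W : Type) (R : rel W), is_omega1 R.
Proof.
have [R woR] := @well_ordering_principle {classic (set nat)}.
pose seg a := [set b : {classic (set nat)} | R b a /\ b <> a].
have unc : ~ countable [set: {classic (set nat)}].
  move=> /countable_injP[f finj].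
  pose D := [set n | exists2 A : set nat, f A = n & ~ A n].
  have Dn : ~ D (f D).
    move=> H; have [A fA nA] := H; apply: nA.
    by rewrite (finj A D (in_setT _) (in_setT _) fA).
  by apply: (Dn); exists D.
have [allc|nallc] := pselect (forall a, countable (seg a)).
  by exists {classic (set nat)}, R; split.
have /woR[z [[zA minz] _]] : nonempty [pred a | `[< ~ countable (seg a) >]].
  by move/existsNP: nallc => [a sa]; exists a; apply/asboolP.
have {}zA : ~ countable (seg z) by move/asboolP: zA.
pose W := {x : {classic (set nat)} | `[< seg z x >]}.
have Ranti : antisymmetric R.
  by move=> x y; apply: (@wo_chain_antisymmetric _ R predT (withinW woR)).
exists W, (fun x y => R (sval x) (sval y)); split.
- move=> A [x Ax].
  have [|m [[mA lm] _]] :=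
      woR [pred y | `[< exists2 u : W, u \in A & sval u = y >]].
    by exists (sval x); apply/asboolP; exists x.
  move/asboolP: mA => [u uA um]; exists u; split.
    by split=> // v vA; rewrite um; apply: lm; apply/asboolP; exists v.
  move=> v [vA lv]; apply: val_inj; apply: Ranti; apply/andP; split.
    by rewrite /= um; apply: lm; apply/asboolP; exists v.
  exact: lv.
- apply: contra_not zA => cW; have -> : seg z = (@sval _ _ : W -> _) @` setT.
    apply/seteqP; split=> [x sx|_ [[x sx] _ <-]]; last exact/asboolP.
    by exists (exist _ x (asboolT sx)).
  exact: sub_countable (card_image_le _ _) cW.
- move=> [a sa].
  have /countable_injP[f finj] : countable (seg a).
    apply: contrapT => nc; have Rza : R z a by apply: minz; apply/asboolP.
    have /asboolP[Raz az] := sa.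
    by apply: az; apply: Ranti; rewrite Raz Rza.
  apply/countable_injP; exists (f \o sval) => x y.
  rewrite !inE /= => -[Rx nx] [Ry ny] fxy; apply: val_inj; apply: finj => //.
    by rewrite inE; split=> // xa; apply: nx; apply: val_inj.
  by rewrite inE; split=> // ya; apply: ny; apply: val_inj.
Qed.

(* The order type of R is at most that of S. *)
Definition otype_le (V W : Type) (R : rel V) (S : rel W) : Prop :=
  exists f : V -> W, {mono f : x y / R x y >-> S x y}.

Definition almost_subset (A B : set nat) : Prop := finite_set (A `\` B).

(* An ordinal-indexed almost decreasing sequence of infinite subsets of omega
   with no infinite pseudointersection; its length is the order type of R. *)
Definition tower (L : Type) (R : rel L) (T : L -> set nat) : Prop :=
  [/\ well_order R,
      forall a, infinite_set (T a),
      forall a b, R a b -> almost_subset (T b) (T a)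
    & ~ exists2 P : set nat,
          infinite_set P & forall a, almost_subset P (T a)].

(* t = the order type of R, where t is the least length of a tower. *)
Definition tower_number_is (W : Type) (R : rel W) : Prop :=
  (exists T : W -> set nat, tower R T) /\
  (forall (L : Type) (S : rel L) (T : L -> set nat),
     tower S T -> otype_le R S).

Definition centered (F : set (set nat)) : Prop :=
  (F `<=` [set B | infinite_set B]) /\
  (forall G : set (set nat), finite_set G -> G !=set0 -> G `<=` F ->
     infinite_set (\bigcap_(B in G) B)).

(* [xsection A n] is the vertical section A(n). *)
Definition NC : set (set (nat * nat)) :=
  [set A | forall X : set nat, infinite_set X ->
             ~ centered [set xsection A n | n in X]].

Definition NC_ad (M : set (set (nat * nat))) : Prop :=
  (M `<=` ~` NC) /\
  (forall A B, M A -> M B -> A <> B -> NC (A `&` B)).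

Definition NC_mad (M : set (set (nat * nat))) : Prop :=
  NC_ad M /\ (forall N, NC_ad N -> M `<=` N -> N = M).

(* The least cardinality of a member of P is the cardinality of K. *)
Definition least_size_is (T U : Type) (P : set (set T)) (K : set U) : Prop :=
  (exists2 M, P M & M #= K) /\ (forall M, P M -> K #<= M).

Definition abar_NC_is (U : Type) (K : set U) : Prop :=
  least_size_is [set M | NC_mad M /\ ~ countable M] K.

(* Main.v *)
Require Import Defs.
From mathcomp Require Import all_boot.
From mathcomp Require Import boolp classical_sets functions cardinality wochoice.

(** A set [B] is [NC]-positive iff some infinite [P] is almost contained in
    [B(n)] for infinitely many [n], because a countable centered family has a
    pseudointersection.  Given a tower [T] of length omega_1, enumerate each
    proper initial segment of omega_1 and let [A_a(n)] be the intersection of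
    the first [n] sets [T_b], [b < a], minus [T_a].  For [a < a'] almost all
    sections of [A_a] and [A_a'] are disjoint.  If [P] is infinite and [a] is
    least such that [P \ T_a] is infinite, then [P \ T_a] is almost contained
    in every [A_a(n)]; hence every positive set meets some [A_a] in a positive
    set, and the positive [A_a] form an [NC]-mad family.  It is uncountable:
    if all positive [A_a] had [a < g], then [P = T_g] would have no such [a]. *)

Set Implicit Arguments.
Unset Strict Implicit.
Unset Printing Implicit Defensive.

Local Open Scope classical_set_scope.
Local Open Scope card_scope.

(** * Infinite sets of naturals and basic facts on well-orders *)

Lemma infinite_nat_unbounded (A : set nat) (n : nat) :
  infinite_set A -> exists2 m, A m & n <= m.
Proof.
move=> Ainf; apply: contrapT => H; apply: Ainf.
apply: (sub_finite_set _ (finite_II n)) => m Am /=.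
by rewrite ltnNge; apply/negP => nm; apply: H; exists m.
Qed.

Lemma unbounded_infinite_nat (A : set nat) :
  (forall n, exists2 m, A m & n <= m) -> infinite_set A.
Proof.
move=> H /finite_seqP[F AF]; pose N := \max_(m <- F) m.
have [m Am Nm] := H N.+1.
have mF : m \in F by move: Am; rewrite AF.
by have := @leq_bigmax_seq _ F xpredT id m mF isT; rewrite leqNgt Nm.
Qed.

Section WellOrder.
Variables (W : Type) (R : rel W).
Hypothesis woR : well_order R.

Lemma well_order_anti (a b : W) : R a b -> R b a -> a = b.
Proof.
move=> ab ba.
apply: (@wo_chain_antisymmetric {classic W} R predT (withinW woR)) => //.
by rewrite ab ba.
Qed.

Lemma well_order_total (a b : W) : R a b \/ R b a.
Proof.
by apply/orP; apply: (@wo_chainW {classic W} R predT (withinW woR)).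
Qed.

Lemma well_order_min (P : W -> Prop) :
  (exists a, P a) -> exists2 a, P a & forall b, P b -> R a b.
Proof.
move=> [a Pa]; have [|m [[/asboolP Pm minm] _]] := woR (A := [pred x | `[< P x >]]).
  by exists a; apply/asboolP.
by exists m => // b Pb; apply: minm; apply/asboolP.
Qed.

Lemma well_order_wf : well_founded (fun b a : W => R b a /\ b <> a).
Proof.
move=> a; apply: contrapT => na.
have [|m nm minm] := @well_order_min (fun x => ~ Acc (fun b a => R b a /\ b <> a) x).
  by exists a.
apply: nm; constructor => b [bm nbm]; apply: contrapT => /minm mb.
exact/nbm/well_order_anti.
Qed.

End WellOrder.

(** * Cardinality and cofinality of omega_1 *)

Section Omega1.
Variables (W : Type) (R : rel W).
Hypothesis omW : is_omega1 R.

(** Well-founded recursion builds an injection: at each stage only countably many values have been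
    used, so the uncountable [M] still offers a new one. *)
Lemma omega1_card_le (T : Type) (M : set T) : ~ countable M -> [set: W] #<= M.
Proof.
case: omW => woR _ segc ncM.
have [t0 _] : M !=set0.
  by apply/set0P/eqP => M0; apply: ncM; rewrite M0.
have ex_new (a : W) (g : forall b : W, R b a /\ b <> a -> T) :
    exists t, M t /\ forall b (h : R b a /\ b <> a), g b h <> t.
  apply: contrapT => H; apply: ncM.
  (* [g'] makes [g] total with the dummy value [t0]; only its image of the countable initial segment
     matters. *)
  pose g' b := if pselect (R b a /\ b <> a) is left h then g b h else t0.
  apply: (@sub_countable _ _ M (g' @` [set b | R b a /\ b <> a])); last first.
    exact: sub_countable (card_image_le _ _) (segc a).
  apply: subset_card_le => t Mt; apply: contrapT => nt; apply: H.
  exists t; split=> // b h ght; apply: nt; exists b => //.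
  by rewrite /g'; case: pselect => // h'; rewrite (Prop_irrelevance h' h).
pose F a g := sval (cid (ex_new a g)).
pose f := Fix (well_order_wf woR) (fun=> T) F.
have fE a : f a = F a (fun b _ => f b).
  rewrite /f Fix_eq // => x g1 g2 eqg; congr F.
  by apply: functional_extensionality_dep => b; apply: funext.
have fM a : M (f a) by rewrite fE /F; case: cid => t [].
have flt a b : R b a -> b <> a -> f b <> f a.
  by move=> ba nba; rewrite (fE a) /F; case: cid => t [_ /= H]; apply: (H b).
have finj : injective f.
  move=> a b fab; apply: contrapT => nab.
  have [ab|ba] := well_order_total woR a b; first exact: (flt b a).
  by apply: (flt a b) => // ba'; apply: nab.
apply: (@card_le_trans _ _ _ (range f)); last by apply: subset_card_le => _ [a _ <-].
have finj' : {in [set: W] &, injective f} by move=> a b _ _; apply: finj.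
by rewrite (card_le_eqr (inj_card_eq finj')).
Qed.

(** Without a strict bound, the closed initial segments below the points of [I] would cover [W], a
    countable union of countable sets. *)
Lemma omega1_countable_bounded (I : set W) : countable I ->
  exists g, forall a, I a -> R a g /\ a <> g.
Proof.
case: omW => woR ncW segc cI; apply: contrapT => H; apply: ncW.
have Icover : [set: W] `<=` \bigcup_(a in I) (a |` [set b | R b a /\ b <> a]).
  move=> g _; apply: contrapT => ng; apply: H; exists g => a Ia.
  have [ag|/= nag] := pselect (a = g).
    by case: ng; exists a => //; left.
  split=> //; have [//|ga] := well_order_total woR a g.
  by case: ng; exists a => //; right; split=> // ga'; apply: nag.
apply: sub_countable (subset_card_le Icover) _.
apply: bigcup_countable => // a _; rewrite -bigcup2E.
apply: bigcup_countable => // -[|[|i]] _ /=.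
- exact: countable1.
- exact: segc.
- exact: countable0.
Qed.

End Omega1.

(** * Pseudointersections and positive sets *)

Lemma centered_pseudointersection (S : nat -> set nat) (X : set nat) :
  centered [set S n | n in X] ->
  exists2 P, infinite_set P & forall n, X n -> almost_subset P (S n).
Proof.
move=> [Sinf Scen].
(* Diagonal choice: [p k] will lie in every [S n] with [n] in [X] and [n <= k], so the range of [p]
   can leave [S n] only at values [p k] with [k < n]. *)
have pex k : exists m, k <= m /\ forall n, X n -> n <= k -> S n m.
  pose G := S @` [set n | X n /\ n <= k].
  have [[C GC]|G0] := pselect (G !=set0).
    have [|m Gm km] := @infinite_nat_unbounded (\bigcap_(B in G) B) k.
      apply: Scen; [|by exists C|by move=> _ [n [Xn _] <-]; exists n].
      by apply: finite_image; apply: sub_finite_set (finite_II k.+1) => n [].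
    by exists m; split=> // n Xn nk; apply: Gm; exists n.
  by exists k; split=> // n Xn nk; case: G0; exists (S n), n.
have [p pP] := choice pex.
exists (range p).
  by apply: unbounded_infinite_nat => k; exists (p k); [exists k | case: (pP k)].
move=> n Xn; apply: (sub_finite_set _ (finite_image p (finite_II n))).
move=> _ [[k _ <-] nS]; exists k => //=; rewrite ltnNge; apply/negP => nk.
by apply: nS; apply: (pP k).2.
Qed.

Lemma NC_positiveP (B : set (nat * nat)) :
  ~ NC B <-> exists X P, [/\ infinite_set X, infinite_set P
    & forall n, X n -> almost_subset P (xsection B n)].
Proof.
split=> [/existsNP[X /not_implyP[Xinf /contrapT cB]]|[X [P [Xinf Pinf PB]]]].
  by have [P Pinf PB] := centered_pseudointersection cB; exists X, P.
(* Converse: an intersection of finitely many sections almost containing [P] almost contains [P]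
   too, hence is infinite. *)
have infB C : almost_subset P C -> infinite_set C.
  move=> PC Cfin; apply: Pinf; apply: (sub_finite_set (B := (P `\` C) `|` C)).
    by move=> x Px; have [Cx|nCx] := pselect (C x); [right | left].
  by rewrite finite_setU.
move=> /(_ X Xinf); apply; split=> [_ [n Xn <-]|G Gfin _ GX].
  exact/infB/PB.
apply: infB.
apply: (sub_finite_set (B := \bigcup_(C in G) (P `\` C))).
  by move=> x [Px /existsNP[C /not_implyP[GC nCx]]]; exists C.
by apply: bigcup_finite => // C /GX[n Xn <-]; apply: PB.
Qed.

(** * The almost disjoint family of gaps in a tower *)

Section TowerFamily.
Variables (W : Type) (R : rel W) (T : W -> set nat) (e : W -> W -> nat).
Hypothesis woR : well_order R.
Hypothesis e_inj : forall a, {in [set b | R b a /\ b <> a] &, injective (e a)}.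

(* [e a] enumerates the predecessors of [a]. *)
Definition tower_gap (a : W) : set (nat * nat) :=
  [set x | (forall b, R b a -> b <> a -> e a b <= x.1 -> T b x.2) /\ ~ T a x.2].

Lemma tower_gap_setI_NC (a b : W) : a <> b -> NC (tower_gap a `&` tower_gap b).
Proof.
wlog ab : a b / R a b => [wlg nab|nab].
  have [|ba] := well_order_total woR a b; first by move/wlg; apply.
  by rewrite setIC; apply: wlg => // ba'; apply: nab.
apply: contrapT => /NC_positiveP[X [P [Xinf Pinf PX]]].
(* From [n = e b a] on, the section of [tower_gap b] lies inside [T a], which [tower_gap a]
   avoids. *)
have [n Xn en] := infinite_nat_unbounded (e b a) Xinf.
apply: Pinf; apply: sub_finite_set (PX n Xn) => m Pm; split=> //.
by move=> /xsectionP[[_ nTa] [Tb _]]; apply: nTa; apply: (Tb a).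
Qed.

(** Equal gaps at distinct indices would coincide with their intersection, which is in [NC]. *)
Lemma tower_gap_inj (a b : W) :
  ~ NC (tower_gap a) -> tower_gap a = tower_gap b -> a = b.
Proof.
move=> pa ab; apply: contrapT => /tower_gap_setI_NC.
by rewrite -ab setIid.
Qed.

(** Since [e a] is injective, the [n]-th section involves only finitely many [T b], each missing
    finitely many points of [P]. *)
Lemma least_gap (P : set nat) (a : W) :
  (forall b, R b a -> b <> a -> almost_subset P (T b)) ->
  forall n, almost_subset (P `\` T a) (xsection (tower_gap a) n).
Proof.
move=> PT n.
pose I := [set b | (R b a /\ b <> a) /\ e a b <= n].
have finI : finite_set I.
  apply: card_le_finite (finite_II n.+1).
  have eI : {in I &, injective (e a)}.
    by move=> b c; rewrite !inE => -[hb _] [hc _]; apply: e_inj; rewrite inE.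
  by rewrite -(card_le_eql (inj_card_eq eI)); apply: subset_card_le => _ [b [_ ?] <-].
apply: (sub_finite_set (B := \bigcup_(b in I) (P `\` T b))).
  move=> m [[Pm nTa] ngap]; apply: contrapT => H; apply: ngap; apply/xsectionP.
  split=> // b ba nba eb; apply: contrapT => nTb; apply: H.
  by exists b.
by apply: bigcup_finite => // b [[ba nba] _]; apply: PT.
Qed.

Lemma infinite_least_gap (P : set nat) : infinite_set P ->
  (exists a, ~ almost_subset P (T a)) ->
  exists a Q, [/\ infinite_set Q, Q `<=` P, ~ almost_subset P (T a)
    & forall n, almost_subset Q (xsection (tower_gap a) n)].
Proof.
move=> Pinf /(well_order_min woR)[a Pa mina].
exists a, (P `\` T a); split=> //; apply: least_gap => b ba nba.
by apply: contrapT => /mina ab; apply: nba; apply: (well_order_anti woR).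
Qed.

Hypothesis towerT : tower R T.

Lemma tower_escape (P : set nat) :
  infinite_set P -> exists a, ~ almost_subset P (T a).
Proof.
case: towerT => _ _ _ noP Pinf; apply: contrapT => H; apply: noP.
by exists P => // a; apply: contrapT => Pa; apply: H; exists a.
Qed.

Lemma tower_gap_mad : NC_mad (tower_gap @` [set a | ~ NC (tower_gap a)]).
Proof.
split; first split.
- by move=> _ [a pa <-].
- move=> _ _ [a _ <-] [b _ <-] nab; apply: tower_gap_setI_NC => ab.
  by apply: nab; rewrite ab.
move=> N [Npos Nad] MN; apply/seteqP; split=> // B NB.
have /NC_positiveP[X [P [Xinf Pinf PX]]] := Npos _ NB.
have [a [Q [Qinf QP _ Qa]]] := infinite_least_gap Pinf (tower_escape Pinf).
have pa : ~ NC (tower_gap a).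
  apply/NC_positiveP; exists [set: nat], Q; split=> //; exact: infinite_nat.
have Na : N (tower_gap a) by apply: MN; exists a.
exists a => //; apply: contrapT => aB.
(* [Q] is almost contained in all sections of [tower_gap a] and, as a subset of [P], in those of [B]
   over [X]. *)
suff : ~ NC (tower_gap a `&` B) by apply; apply: Nad.
apply/NC_positiveP; exists X, Q; split=> // n Xn.
rewrite /almost_subset xsectionI setDIr finite_setU; split; first exact: Qa.
by apply: sub_finite_set (PX n Xn) => m [/QP Pm nB].
Qed.

Lemma tower_gap_uncountable : is_omega1 R ->
  ~ countable (tower_gap @` [set a | ~ NC (tower_gap a)]).
Proof.
move=> omW; rewrite (eq_countable (inj_card_eq _)); last first.
  by move=> a b; rewrite !inE => pa _; apply: tower_gap_inj.
move=> /(omega1_countable_bounded omW)[g gP].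
case: towerT => _ Tinf Tdec _.
(* [Q] makes [tower_gap a] positive, so [a] lies below [g]; but then [T g] is almost contained in
   [T a], against [Ta]. *)
have [a [Q [Qinf _ Ta Qa]]] := infinite_least_gap (Tinf g) (tower_escape (Tinf g)).
apply: Ta; apply: Tdec; apply: (gP a _).1.
apply/NC_positiveP; exists [set: nat], Q; split=> //; exact: infinite_nat.
Qed.

End TowerFamily.

Theorem theorem2p8 (omega1 : Type) (le1 : rel omega1)
    (h_omega1 : is_omega1 le1) (h_t : tower_number_is le1) :
  abar_NC_is [set: omega1]%classic.
Proof.
have [woR _ segc] := h_omega1; have [[T towerT] _] := h_t.
have [e e_inj] : exists e : omega1 -> omega1 -> nat,
    forall a, {in [set b | le1 b a /\ b <> a] &, injective (e a)}.
  exists (fun a => sval (cid (elimT (countable_injP _) (segc a)))) => a.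
  by case: cid.
split=> [|M [_ ncM]]; last exact: (omega1_card_le h_omega1).
have ncG := tower_gap_uncountable woR e_inj towerT h_omega1.
exists (tower_gap le1 T e @` [set a | ~ NC (tower_gap le1 T e a)]).
  by split=> //; apply: tower_gap_mad.
(* The upper bound holds because the family is indexed by a subset of [omega1]. *)
rewrite card_eq_le (omega1_card_le h_omega1) // andbT.
exact: card_le_trans (card_image_le _ _) (card_leT _).
Qed.
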